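(* Let $H$ be a covering $3$-hypergraph of order $n\geq 7$. Then $H$ is eulerian.
   Context: A hypergraph $H=(V,E)$ has a finite non-empty vertex set $V$ and a finite multiset $E$ of subsets of $V$ (edges; distinct members of the multiset are distinct edges); its order is $|V|$. A covering $3$-hypergraph is a hypergraph with at least one edge, all of whose edges have exactly 3 elements, in which every pair of distinct vertices is contained in at least one edge. A walk is a sequence $v_0e_1v_1\dots e_mv_m$ with $v_i\in V$, $e_i\in E$, $v_{i-1},v_i\in e_i$, $v_{i-1}\neq v_i$; it is a trail if the $e_i$ are pairwise distinct, and closed if $v_0=v_m$ and $m\ge2$. An Euler tour is a closed trail traversing every edge exactly once; $H$ is eulerian if it has no edges or admits an Euler tour. *)

(* Defs.v *)
From mathcomp Require Import all_boot.

Set Implicit Arguments.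
Unset Strict Implicit.
Unset Printing Implicit Defensive.

(* The finite multiset of edges is a family of vertex sets indexed by a finite
   type: [edge H] is the type of (pairwise distinct) edges, and two distinct
   edges e, f may be parallel, i.e. satisfy [ends e = ends f]. *)
Record hypergraph := Hypergraph {
  vertex : finType;
  edge : finType;
  ends : edge -> {set vertex};
  vertex_nonempty : 0 < #|vertex|
}.

Definition horder (H : hypergraph) : nat := #|vertex H|.

Definition covering_3hypergraph (H : hypergraph) : Prop :=
  [/\ 0 < #|edge H|,
      forall e : edge H, #|ends e| = 3
    & forall u v : vertex H, u != v ->
        exists e : edge H, (u \in ends e) && (v \in ends e)].

Section Walks.

Variable H : hypergraph.

(* The sequence v_0 e_1 v_1 ... e_m v_m is represented by its first vertex v_0
   together with the list w = [:: (e_1, v_1); ...; (e_m, v_m)], so m = size w. *)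
Fixpoint is_walk (v : vertex H) (w : seq (edge H * vertex H)) : bool :=
  if w is (e, v') :: w' then
    [&& v \in ends e, v' \in ends e, v != v' & is_walk v' w']
  else true.

Definition is_trail (v : vertex H) (w : seq (edge H * vertex H)) : bool :=
  is_walk v w && uniq (unzip1 w).

Definition is_closed (v : vertex H) (w : seq (edge H * vertex H)) : bool :=
  (v == last v (unzip2 w)) && (2 <= size w).

Definition euler_tour (v : vertex H) (w : seq (edge H * vertex H)) : Prop :=
  [/\ is_trail v w, is_closed v w
    & forall e : edge H, count_mem e (unzip1 w) = 1].

Definition eulerian : Prop :=
  #|edge H| = 0 \/ exists v w, euler_tour v w.

End Walks.

(* Main.v *)
Require Import Defs.
From mathcomp Require Import all_boot.
From Stdlib Require Import Classical.

(* Choosing in every edge one vertex to omit turns the hypergraph into a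
   multigraph of kept pairs; an Euler tour exists as soon as all its degrees are
   even and all its edges lie in one component (Hierholzer). Re-choosing omitted
   vertices along a closed chain u, v, ..., u, where consecutive vertices are
   contained in distinct edges that omit one of the two, preserves parities, and
   an open chain fixes two odd vertices. An even choice exists by a counting
   argument on such chains.

   Take an even choice whose largest component B is as large as possible, and
   suppose that the complement A still contains kept pairs. A closed chain
   through three components would enlarge B, so A is one component. For a in A
   and b in B every edge through a and b omits b ("alpha") or a ("beta").
   Maximality excludes any closed chain that removes at most one pair of B and
   joins B to A, as well as any chain after which all vertices but one are
   connected. Such chains of length at most 4 show: no pair is both alpha and
   beta; if a is alpha at b1 and b2, some edge keeps b1 b2 and omits a vertex of
   A; a non-cut vertex b of B is beta for at most one vertex of A. Hence
   any two non-cut vertices of B form a kept pair whose omitted vertex is the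
   unique beta vertex of both, so B has at most two non-cut vertices and they are
   adjacent, which forces #|B| <= 2 and #|V| <= 4. *)

Set Implicit Arguments.
Unset Strict Implicit.
Unset Printing Implicit Defensive.

(** * Omissions, kept pairs, and re-choosing along chains of edges *)

Section Omission.

Variables (V E : finType) (ends : E -> {set V}).
Hypothesis card_ends : forall e, #|ends e| = 3.
Hypothesis cover : forall u v, u != v ->
  exists e, (u \in ends e) && (v \in ends e).

Implicit Types (o : E -> V) (Q : V -> bool) (e f : E) (S : {set V}).

Definition valid o := forall e, o e \in ends e.
Definition inc o e x := (x \in ends e) && (o e != x).
Definition even_omission o := forall x, \big[addb/false]_e inc o e x = false.
(* The parity of the number of kept vertices of e in Q: true iff Q separates the
   kept pair of e. *)
Definition crosses o Q e := \big[addb/false]_(x | inc o e x) Q x.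
Definition triple o e x w y : Prop :=
  [/\ ends e = [set x; w; y], x != w, x != y, w != y & o e = y].
(* S lies in one component of the multigraph of kept pairs. *)
Definition linked o S := forall Q, (forall e, crosses o Q e = false) ->
  {in S &, forall x y, Q x = Q y}.

Lemma tripleC o e x w y : triple o e x w y -> triple o e w x y.
Proof.
case=> ee xw xy wy oe; split; rewrite // 1?eq_sym //.
by rewrite ee [[set w; x]]setUC.
Qed.

Lemma triple_ex o e : valid o -> exists x w, triple o e x w (o e).
Proof.
move=> /(_ e) oe; have: #|ends e :\ o e| == 2.
  by have := cardsD1 (o e) (ends e); rewrite card_ends oe add1n => -[<-].
case/cards2P=> x [w] [xw def]; exists x, w.
have [xD wD] : x \in ends e :\ o e /\ w \in ends e :\ o e.
  by rewrite def !inE !eqxx orbT.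
move: xD wD; rewrite !in_setD1 => /andP[xo _] /andP[wo _].
by split; rewrite // -(setD1K oe) def setUC.
Qed.

Lemma triple_inc o e x w y v : triple o e x w y ->
  inc o e v = (v == x) || (v == w).
Proof.
case=> ee xw xy wy oe; rewrite /inc ee oe !inE.
have [->|] := eqVneq v x; first by rewrite [y == x]eq_sym xy.
have [->|] := eqVneq v w; first by rewrite [y == w]eq_sym wy.
by move=> _ _; rewrite [v == y]eq_sym andbN.
Qed.

Lemma triple_crosses o Q e x w y : triple o e x w y ->
  crosses o Q e = Q x (+) Q w.
Proof.
move=> t; have [_ xw _ _ _] := t; rewrite /crosses.
rewrite (eq_bigl (mem [set x; w])) => [|v]; last by rewrite (triple_inc v t) !inE.
by rewrite big_setU1 ?inE //= big_set1.
Qed.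

Lemma triple_pair o e x w y x' w' y' :
  triple o e x w y -> triple o e x' w' y' ->
  [/\ x' = x, w' = w & y' = y] \/ [/\ x' = w, w' = x & y' = y].
Proof.
move=> t t'; have [_ xw' _ _ oy] := t'; have [_ _ _ _ ox] := t.
have := triple_inc x' t; have := triple_inc w' t.
rewrite !(triple_inc _ t') !eqxx orbT /=.
move=> /esym/orP[]/eqP ew /esym/orP[]/eqP ex; subst; rewrite ?eqxx // in xw' *.
  by right.
by left.
Qed.

Lemma cover_triple o u v : valid o -> u != v -> exists e w,
  [\/ triple o e u v w, triple o e u w v | triple o e v w u].
Proof.
move=> vo uv; have [e /andP[ue ve]] := cover uv.
have [x [w t]] := triple_ex e vo; have [ee _ _ _ _] := t; exists e.
move: ue ve uv; rewrite ee !inE -!orbA.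
move=> /or3P[]/eqP-> /or3P[]/eqP-> uv; rewrite ?eqxx // in uv *.
- by exists (o e); constructor 1.
- by exists w; constructor 2.
- by exists (o e); constructor 1; apply: tripleC.
- by exists x; constructor 2; apply: tripleC.
- by exists w; constructor 3.
- by exists x; constructor 3; apply: tripleC.
Qed.

(** Handshake argument: exchanging the two sums weights [Q x] by the degree parity of [x]. *)
Lemma even_crosses o Q : even_omission o ->
  \big[addb/false]_e crosses o Q e = false.
Proof.
move=> ev; rewrite /crosses.
under eq_bigr => e _ do rewrite big_mkcond.
rewrite exchange_big /= big1 // => x _.
case: (Q x); last by rewrite big1 // => e _; rewrite if_same.
by rewrite -[RHS](ev x); apply: eq_bigr => e _; case: inc.
Qed.

(* A step (e, x, w, y) on an edge with kept pair {x, w} and omitted vertex y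
   makes x the omitted vertex, so that {w, y} becomes the kept pair. *)
Definition step := (E * V * V * V)%type.
Definition st_edge (t : step) := t.1.1.1.
Definition st_from (t : step) := t.1.1.2.
Definition st_mid (t : step) := t.1.2.
Definition st_to (t : step) := t.2.

Fixpoint each (P : step -> Prop) (l : seq step) : Prop :=
  if l is t :: l' then P t /\ each P l' else True.

Fixpoint steps o (l : seq step) : Prop :=
  if l is t :: l' then
    [/\ triple o (st_edge t) (st_from t) (st_mid t) (st_to t),
        st_edge t \notin map st_edge l' & steps o l']
  else True.

(** A step changes the degree parity exactly at its [st_from] and [st_to]; here these changes
    cancel, as along a closed chain. *)
Definition balanced (l : seq step) := forall v,
  foldr (fun t b => (st_from t == v) (+) (st_to t == v) (+) b) false l = false.

Definition apply_steps o (l : seq step) : E -> V :=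
  foldr (fun t o' f => if f == st_edge t then st_from t else o' f) o l.

Lemma apply_steps_out o l f : f \notin map st_edge l -> apply_steps o l f = o f.
Proof.
by elim: l => //= t l IH; rewrite inE negb_or => /andP[/negPf-> /IH].
Qed.

Lemma apply_steps_in o l : steps o l ->
  each (fun t => triple (apply_steps o l) (st_edge t) (st_mid t) (st_to t) (st_from t)) l.
Proof.
move=> st.
have o'E t : t \in l -> apply_steps o l (st_edge t) = st_from t.
  elim: l st => //= s l IH [_ sl st]; rewrite inE => /orP[/eqP->|tl].
    by rewrite eqxx.
  by rewrite -(IH st tl); case: eqP => // ets; rewrite -ets map_f in sl.
(* [apply_steps o l] must stay fixed during the induction, so the induction runs over a separate
   list of steps of [l]. *)
suff H l' : {subset l' <= l} -> steps o l' -> each (fun t => triple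
    (apply_steps o l) (st_edge t) (st_mid t) (st_to t) (st_from t)) l'.
  exact: H.
elim: l' => //= t l' IH sub [[ee xw xy wy oe] _ st']; split; last first.
  by apply: IH => // s sl; apply: sub; rewrite inE sl orbT.
split; rewrite // 1?eq_sym //; last by apply: o'E; apply: sub; rewrite inE eqxx.
by rewrite ee -setUA setUC.
Qed.

Lemma apply_steps_valid o l : valid o -> steps o l -> valid (apply_steps o l).
Proof.
elim: l => //= t l IH vo [[ee _ _ _ _] _ st] f.
by case: eqP => [->|_]; [rewrite ee !inE eqxx | apply: IH].
Qed.

Lemma apply_steps_parity o l v : steps o l ->
  \big[addb/false]_e inc (apply_steps o l) e v = (\big[addb/false]_e inc o e v)
  (+) foldr (fun t b => (st_from t == v) (+) (st_to t == v) (+) b) false l.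
Proof.
elim: l => /= [_|t l IH [[ee xw xy wy oe] tl st]]; first by rewrite addbF.
rewrite [RHS]addbCA -IH // (bigD1 (st_edge t)) //= [in RHS](bigD1 (st_edge t)) //=.
rewrite addbA; congr (_ (+) _).
  rewrite /inc eqxx apply_steps_out // oe ee !inE.
  rewrite ![v == _]eq_sym; have [<-|] := eqVneq (st_from t) v.
    by rewrite [st_to t == _]eq_sym (negPf xy).
  by have [<-|] := eqVneq (st_to t) v; rewrite ?orbT ?orbF.
by apply: eq_bigr => f /negPf ft; rewrite /inc ft.
Qed.

Lemma apply_steps_even o l : even_omission o -> steps o l -> balanced l ->
  even_omission (apply_steps o l).
Proof. by move=> ev st bal v; rewrite apply_steps_parity // ev bal. Qed.

Ltac case_eqs v :=
  repeat match goal with |- context [?a == v] => case: (a == v) end.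

Ltac case_values Q :=
  repeat match goal with |- context [Q ?a] => case: (Q a) end.

(** * Unions of components and the parity of cuts *)

Definition closed_side o S :=
  forall e x w y, triple o e x w y -> (x \in S) = (w \in S).

Section Sides.

Variables (o : E -> V) (S : {set V}).
Hypotheses (vo : valid o) (ev : even_omission o) (clS : closed_side o S).

Lemma crosses_restrict Q e x w y : triple o e x w y ->
  crosses o (fun v => (v \in S) && Q v) e = (x \in S) && (Q x (+) Q w).
Proof.
by move=> t; rewrite (triple_crosses _ t) -(clS t); case: (x \in S).
Qed.

Lemma restrict_other Q (l : seq E) :
  (forall f, f \notin l -> crosses o Q f = false) ->
  forall f, f \notin l -> crosses o (fun v => (v \in S) && Q v) f = false.
Proof.
move=> oth f fl; have [x [w t]] := triple_ex f vo.
by rewrite (crosses_restrict _ t) -(triple_crosses _ t) oth // andbF.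
Qed.

(* A cut of an even graph has an even number of edges. *)
Lemma side_cut Q l : steps o l ->
  (forall f, f \notin map st_edge l -> crosses o Q f = false) ->
  foldr (fun t b => ((st_from t \in S) && (Q (st_from t) (+) Q (st_mid t))) (+) b)
    false l = false.
Proof.
move=> st oth; rewrite -[RHS](even_crosses (fun v => (v \in S) && Q v) ev).
rewrite [RHS](bigID [in map st_edge l]) /= [X in _ (+) X]big1 ?addbF; last first.
  by move=> f; apply: restrict_other oth f.
rewrite -big_uniq /=; last by elim: l st {oth} => //= t l IH [_ -> /IH].
elim: l st {oth} => /= [_|t l IH [tt _ st]]; first by rewrite big_nil.
by rewrite big_cons -IH // (crosses_restrict _ tt).
Qed.

(** Only pairs removed by [l] could be crossed inside [S]; once these are excluded, [Q] restricted
    to [S] is uncrossed and linkedness applies. *)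
Lemma side_const Q l : linked o S -> steps o l ->
  (forall f, f \notin map st_edge l -> crosses o Q f = false) ->
  each (fun t => st_from t \in S -> Q (st_from t) = Q (st_mid t)) l ->
  {in S &, forall x y, Q x = Q y}.
Proof.
move=> lk st oth eq x y xS yS.
have := lk (fun v => (v \in S) && Q v); rewrite /prop_in2.
move/(_ _ x y xS yS); rewrite xS yS; apply=> e.
have [el|] := boolP (e \in map st_edge l); last exact: restrict_other.
elim: l st eq el {oth} => //= t l IH [tt _ st] [tS eq].
rewrite inE => /orP[/eqP->|/IH->] //; rewrite (crosses_restrict _ tt).
by case: (_ \in S) tS => // ->; rewrite ?addbb.
Qed.

End Sides.

(** * Exchange arguments at a linked set of maximal size *)

Section Maximal.

Variables (o : E -> V) (B : {set V}).
Hypotheses (vo : valid o) (ev : even_omission o) (lkB : linked o B).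
Hypothesis maxB : forall o' S,
  valid o' -> even_omission o' -> linked o' S -> #|S| <= #|B|.

Local Notation tr := (triple o).

Lemma closedB : closed_side o B.
Proof.
suff H e x w y : tr e x w y -> x \in B -> w \in B.
  by move=> e x w y t; apply/idP/idP; apply: H; [exact: t | apply: tripleC t].
move=> t xB; apply: contraT => wB.
suff /(maxB vo ev) : linked o (w |: B) by rewrite cardsU1 wB add1n ltnn.
move=> Q Q0; have Qw : Q w = Q x.
  by have := Q0 e; rewrite (triple_crosses _ t); do 2 case: (Q _).
have QB := lkB Q0; move=> u v; rewrite !inE.
by move=> /orP[/eqP->|uB] /orP[/eqP->|vB] //; rewrite ?Qw; apply: QB.
Qed.

Lemma closedA : closed_side o (~: B).
Proof. by move=> e x w y t; rewrite !inE (closedB t). Qed.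

(** The form in which maximality is used. After [l], each changed edge keeps its [st_mid] and
    [st_to], so the colourings in the last hypothesis are those uncrossed by the new omission, and
    [S] would be linked for it. *)
Lemma stuck l S : steps o l -> balanced l -> #|B| < #|S| ->
  (forall Q, (forall f, f \notin map st_edge l -> crosses o Q f = false) ->
     each (fun t => Q (st_mid t) = Q (st_to t)) l ->
     {in S &, forall x y, Q x = Q y}) -> False.
Proof.
move=> st bal lt H; have vo' := apply_steps_valid vo st.
suff /(maxB vo' (apply_steps_even ev st bal)) : linked (apply_steps o l) S.
  by rewrite leqNgt lt.
move=> Q Q0; apply: H => [f fl|].
  rewrite -(Q0 f); apply: eq_bigl => x.
  by rewrite /inc apply_steps_out.
move: (apply_steps o l) (apply_steps_in st) Q0 => o' tr' Q0.
elim: (l) tr' => //= t l' IH [tt /IH]; split=> //.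
by have := Q0 (st_edge t); rewrite (triple_crosses _ tt); do 2 case: (Q _).
Qed.

Lemma stuck_grow l w b : steps o l -> balanced l -> w \notin B -> b \in B ->
  (forall Q, (forall f, f \notin map st_edge l -> crosses o Q f = false) ->
     each (fun t => Q (st_mid t) = Q (st_to t)) l ->
     {in B &, forall x y, Q x = Q y} /\ Q w = Q b) -> False.
Proof.
move=> st bal wB bB H; apply: (@stuck l (w |: B)) => // [|Q Q0 Ql].
  by rewrite cardsU1 wB.
have [QB Qw] := H Q Q0 Ql; move=> u v; rewrite !inE.
by move=> /orP[/eqP->|uB] /orP[/eqP->|vB] //; rewrite ?Qw; apply: QB.
Qed.

(** An even multigraph has no bridge: the cut that [Q] defines in [S] is even, so it cannot consist
    of the only pair that [l] removes from [S]. *)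
Lemma side_const1 S l Q : closed_side o S -> linked o S -> steps o l ->
  (forall f, f \notin map st_edge l -> crosses o Q f = false) ->
  count (fun t => st_from t \in S) l <= 1 ->
  {in S &, forall x y, Q x = Q y}.
Proof.
move=> clS lk st oth cnt; apply: (side_const vo clS lk st oth).
have := side_cut vo ev clS st oth; elim: l cnt {st oth} => //= t l IH.
case: (st_from t \in S) => /= [|cnt eq]; last by split=> //; apply: IH.
rewrite add1n ltnS leqn0 => /eqP l0.
have [-> el] : foldr (fun t b => ((st_from t \in S)
    && (Q (st_from t) (+) Q (st_mid t))) (+) b) false l = false
  /\ each (fun t => st_from t \in S -> Q (st_from t) = Q (st_mid t)) l.
  elim: l l0 {IH} => //= s l IH; case: (_ \in S) => //= /IH[-> el].
  by split.
by rewrite addbF => H; split=> // _; move: H; do 2 case: (Q _).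
Qed.

Lemma side_local S Q : closed_side o S -> linked o S ->
  (forall e x w y, tr e x w y -> x \in S -> Q x = Q w) ->
  {in S &, forall x y, Q x = Q y}.
Proof.
move=> clS lk H x y xS yS.
have := lk (fun v => (v \in S) && Q v); rewrite /prop_in2.
move/(_ _ x y xS yS); rewrite xS yS; apply=> e.
have [u [w t]] := triple_ex e vo; rewrite (crosses_restrict clS _ t).
by case: (boolP (u \in S)) => // uS; rewrite (H _ _ _ _ t uS) addbb.
Qed.

(** * Cut vertices and non-cut vertices of the large side *)

Definition noncut b := b \in B /\ forall Q,
  (forall e x w y, tr e x w y -> x \in B -> x != b -> w != b -> Q x = Q w) ->
  {in B :\ b &, forall x y, Q x = Q y}.

Lemma noncut_const b l Q : noncut b -> steps o l ->
  (forall f, f \notin map st_edge l -> crosses o Q f = false) ->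
  each (fun t => st_from t \in B -> st_from t != b -> st_mid t != b ->
    Q (st_from t) = Q (st_mid t)) l ->
  {in B :\ b &, forall x y, Q x = Q y}.
Proof.
case=> _ nc st oth eq; apply: nc => e x w y t xB xb wb.
have [el|/oth] := boolP (e \in map st_edge l); last first.
  by rewrite (triple_crosses _ t); do 2 case: (Q _).
elim: l st eq el {oth} => //= s l IH [ts _ st] [eqs eq].
rewrite inE => /orP[/eqP es|/IH->] //; subst e.
have [[ex ew _]|[ex ew _]] := triple_pair ts t; subst x w; first exact: eqs.
by rewrite eqs // (closedB ts).
Qed.

Lemma cut_separation v : v \in B -> ~ noncut v ->
  exists Q, (forall e x w y, tr e x w y ->
    x \in B -> x != v -> w != v -> Q x = Q w) /\
    exists x y, [/\ x \in B :\ v, y \in B :\ v & Q x <> Q y].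
Proof.
move=> vB ncv; apply: NNPP => H; apply: ncv; split=> // Q Qv x y xB yB.
by apply: NNPP => Qxy; apply: H; exists Q; split=> //; exists x, y.
Qed.

(** A non-empty union of components of the graph induced on [B :\ c]. *)
Definition piece c (K : {set V}) := [/\ c \in B, K \subset B :\ c, K != set0 &
  forall e x w y, tr e x w y -> x \in B -> x != c -> w != c ->
    (x \in K) = (w \in K)].

(* If v in K is a cut vertex then B \ K, which is connected through c, lies in
   one component of B \ v, so the other components of B \ v are smaller pieces. *)
Lemma piece_noncut c K : piece c K -> exists2 v, v \in K & noncut v.
Proof.
have [n] := ubnP #|K|; elim: n c K => // n IH c K lt [cB KB K0 clK].
have /set0Pn[v vK] := K0.
have cK : c \notin K.
  by apply/negP => /(subsetP KB); rewrite !inE eqxx.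
have vB : v \in B by have /(subsetP KB) := vK; rewrite !inE => /andP[].
case: (classic (noncut v)) => [|ncv]; first by exists v.
have [Q [Qv [x [y [xB yB Qxy]]]]] := cut_separation vB ncv.
pose K2 := [set z in B :\ v | Q z != Q c].
have K2B : K2 \subset B :\ v by apply/subsetP => z; rewrite inE => /andP[].
have K2K : K2 \subset K :\ v.
  apply/subsetP => z; rewrite !inE => /andP[/andP[zv zB] Qz]; rewrite zv /=.
  apply: contraT => zK.
  (* Painting [K] with the colour of [c] is constant along the pairs of [B]: a pair meeting [K] has
     its other end in [K] or at [c], and any other pair avoids [v]. *)
  suff QB : {in B &, forall x y, (if x \in K then Q c else Q x) =
      (if y \in K then Q c else Q y)}.
    by have := QB z c zB cB; rewrite (negPf zK) (negPf cK) => /eqP; rewrite (negPf Qz).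
  apply: (side_local closedB lkB) => e u w t tt uB.
  have wB : w \in B by rewrite -(closedB tt).
  have [uc|uc] := eqVneq u c.
    rewrite uc (negPf cK); case: ifP => // /negP wK.
    rewrite -uc; apply: (Qv _ _ _ _ tt) => //.
      by apply: contraNneq cK => uv; rewrite -uc uv.
    by apply/eqP => wv; rewrite wv in wK.
  have [wc|wc] := eqVneq w c.
    rewrite wc (negPf cK); case: ifP => // /negP uK.
    rewrite -wc; apply: (Qv _ _ _ _ tt) => //.
      by apply/eqP => uv; rewrite uv in uK.
    by apply: contraNneq cK => wv; rewrite -wc wv.
  rewrite -(clK _ _ _ _ tt) //; case: ifP => // /negP uK.
  apply: (Qv _ _ _ _ tt) => //; first by apply/eqP => uv; rewrite uv in uK.
  by apply/eqP => wv; apply: uK; rewrite (clK _ _ _ _ tt) // wv.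
have [||z zK2 ncz] := IH v K2.
- apply: leq_ltn_trans (subset_leq_card K2K) _.
  by move: lt; rewrite (cardsD1 v K) vK add1n ltnS.
- split=> //.
    apply/set0Pn; case: (eqVneq (Q x) (Q c)) => [Qx|Qx]; last first.
      by exists x; rewrite inE xB Qx.
    by exists y; rewrite inE yB -Qx; apply/eqP => /esym.
  move=> e u w t tt uB uv wv; rewrite !inE uv wv uB -(closedB tt) uB /=.
  by rewrite (Qv _ _ _ _ tt).
by exists z => //; have := subsetP K2K z zK2; rewrite inE => /andP[].
Qed.

(** For any [c] in [B], the whole of [B :\ c] is a piece at [c]. *)
Lemma exists_noncut : 1 < #|B| -> exists b, noncut b.
Proof.
move=> B1; have /set0Pn[c cB] : B != set0 by rewrite -card_gt0 ltnW.
have [|b _ ncb] := @piece_noncut c (B :\ c); last by exists b.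
split=> //; first by rewrite -card_gt0; move: B1; rewrite (cardsD1 c) cB.
by move=> e x w y t xB xc wc; rewrite !inE xc wc (closedB t).
Qed.

(** A cut vertex [v] splits [B :\ v] into two colour classes, both pieces at [v]; non-cut vertices
    from different classes form no kept pair. *)
Lemma all_noncut_or_nonadjacent :
  (forall b, b \in B -> noncut b) \/
  (exists b b', [/\ noncut b, noncut b', b != b' & forall e y, ~ tr e b b' y]).
Proof.
case: (classic (forall b, b \in B -> noncut b)) => [|H]; first by left.
right; have {H}[v [vB ncv]] : exists v, v \in B /\ ~ noncut v.
  apply: NNPP => H'; apply: H => b bB; apply: NNPP => ncb.
  by apply: H'; exists b.
have [Q [Qv [x [y [xB yB Qxy]]]]] := cut_separation vB ncv.
have pc z : z \in B :\ v -> piece v [set u in B :\ v | Q u == Q z].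
  move=> zB; split=> //; first by apply/subsetP => u; rewrite inE => /andP[].
    by apply/set0Pn; exists z; rewrite inE zB /=.
  move=> e u w t tt uB uv wv; rewrite !inE uv wv uB -(closedB tt) uB /=.
  by rewrite (Qv _ _ _ _ tt).
have [b] := piece_noncut (pc x xB); rewrite !inE => /andP[/andP[bv bB] /eqP Qb] nb.
have [b'] := piece_noncut (pc y yB); rewrite !inE => /andP[/andP[bv' bB'] /eqP Qb'] nb'.
exists b, b'; split=> // [|e u tt].
  by apply/eqP => bb; apply: Qxy; rewrite -Qb -Qb' bb.
by apply: Qxy; rewrite -Qb -Qb' (Qv _ _ _ _ tt).
Qed.

(** * The complement of the large side is one component *)

Lemma cover_sides u v Q : (forall e, crosses o Q e = false) -> Q u != Q v ->
  exists e w, tr e u w v \/ tr e v w u.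
Proof.
move=> Q0 Quv; have uv : u != v by apply: contraNneq Quv => ->.
have [e [w [t|t|t]]] := cover_triple vo uv; exists e, w; [|by left|by right].
have := Q0 e; rewrite (triple_crosses _ t).
by move: Quv; do 2 case: (Q _).
Qed.

Lemma side_crosses e : crosses o (fun v => v \in B) e = false.
Proof.
have [x [w t]] := triple_ex e vo.
by rewrite (triple_crosses _ t) (closedB t) addbb.
Qed.

Lemma alpha_beta a b : a \notin B -> b \in B ->
  exists e w, tr e a w b \/ tr e b w a.
Proof.
move=> aB bB; apply: (cover_sides side_crosses).
by rewrite bB (negPf aB).
Qed.

Lemma triple_neq e1 x1 w1 y1 e2 x2 w2 y2 :
  tr e1 x1 w1 y1 -> tr e2 x2 w2 y2 -> y1 != y2 -> e1 != e2.
Proof.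
by case=> _ _ _ _ <- [_ _ _ _ <-]; apply: contraNneq => ->.
Qed.

Lemma steps2 e1 x1 w1 y1 e2 x2 w2 y2 :
  tr e1 x1 w1 y1 -> tr e2 x2 w2 y2 -> e1 != e2 ->
  steps o [:: (e1, x1, w1, y1); (e2, x2, w2, y2)].
Proof. by move=> t1 t2 n; split; rewrite //= inE. Qed.

Lemma steps3 e1 x1 w1 y1 e2 x2 w2 y2 e3 x3 w3 y3 :
  tr e1 x1 w1 y1 -> tr e2 x2 w2 y2 -> tr e3 x3 w3 y3 ->
  e1 != e2 -> e1 != e3 -> e2 != e3 ->
  steps o [:: (e1, x1, w1, y1); (e2, x2, w2, y2); (e3, x3, w3, y3)].
Proof.
move=> t1 t2 t3 n12 n13 n23; split=> //; last exact: steps2.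
by rewrite /= !inE negb_or; apply/andP.
Qed.

Lemma steps4 e1 x1 w1 y1 e2 x2 w2 y2 e3 x3 w3 y3 e4 x4 w4 y4 :
  tr e1 x1 w1 y1 -> tr e2 x2 w2 y2 -> tr e3 x3 w3 y3 -> tr e4 x4 w4 y4 ->
  e1 != e2 -> e1 != e3 -> e1 != e4 -> e2 != e3 -> e2 != e4 -> e3 != e4 ->
  steps o [:: (e1, x1, w1, y1); (e2, x2, w2, y2); (e3, x3, w3, y3);
              (e4, x4, w4, y4)].
Proof.
move=> t1 t2 t3 t4 n12 n13 n14 n23 n24 n34; split=> //; last exact: steps3.
by rewrite /= !inE !negb_or; apply/and3P.
Qed.

Ltac solve_balanced :=
  let v := fresh "v" in
  by move=> v; rewrite /st_from /st_to /=; case_eqs v.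

Lemma side_neq a b : a \notin B -> b \in B -> a != b.
Proof. by move=> aB; apply: contraTneq => <-. Qed.

Ltac solve_neq := first [by [] | by rewrite eq_sym | by apply: side_neq
  | by rewrite eq_sym; apply: side_neq].

(** If [a] and [c] were in different components outside [B], a non-cut vertex [b] of [B] would
    complete them to a closed chain of three edges, one through each two of the vertices. *)
Lemma linkedA : 1 < #|B| -> linked o (~: B).
Proof.
move=> B1 Q0 cQ0 a c; rewrite !inE => aB cB; apply/eqP/negPn/negP => Qac.
have [b ncb] := exists_noncut B1; have [bB _] := ncb.
have ac : a != c by apply: contraNneq Qac => ->.
have ab := side_neq aB bB; have cb := side_neq cB bB.
have [e1 [w1 T1]] := alpha_beta aB bB; have [e2 [w2 T2]] := alpha_beta cB bB.
have [e3 [w3 T3]] := cover_sides cQ0 Qac.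
(* A common edge would have to omit [b] and keep [a c], a pair that [Q0] separates. *)
have n12 : e1 != e2.
  case: T1 T2 => T1 [] T2.
  - apply/eqP => e12; subst e2; have := cQ0 e1; rewrite (triple_crosses _ T1).
    have [[eq _ _]|[eq _ _]] := triple_pair T1 T2; first by rewrite eq eqxx in ac.
    by move: Qac; rewrite -eq; do 2 case: (Q0 _).
  - by apply: triple_neq T1 T2 _; rewrite eq_sym.
  - by apply: triple_neq T1 T2 _.
  - by apply: triple_neq T1 T2 _.
have nB x e e' w w' y : x \notin B -> tr e b w y -> tr e' x w' y -> e != e'.
  move=> xB t t'; apply/eqP => ee; subst e'; have := closedB t; rewrite bB.
  have [[eq _ _]|[eq _ _]] := triple_pair t t'; subst x; first by rewrite bB in xB.
  by rewrite (negPf xB).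
have n13 : e1 != e3.
  case: T1 T3 => T1 [] T3; try by apply: triple_neq T1 T3 _; rewrite // eq_sym.
  exact: nB cB T1 T3.
have n23 : e2 != e3.
  case: T2 T3 => T2 [] T3; try by apply: triple_neq T2 T3 _; rewrite // eq_sym.
  exact: nB aB T2 T3.
have f3 : exists x3 y3, [/\ x3 \notin B, tr e3 x3 w3 y3 &
    forall v, (x3 == v) (+) (y3 == v) = (a == v) (+) (c == v)].
  case: T3 => T3; [exists a, c | exists c, a]; split=> // v.
  by rewrite addbC.
have [x3 [y3 [x3B {}T3 bal3]]] := f3.
have wB e x w y : x \notin B -> tr e x w y -> w \notin B.
  by move=> xB /closedB <-.
(* If one of the two edges omits [b], at most one pair of [B] is removed, and a new pair joins [b]
   to a vertex outside [B]. *)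
case: T1 T2 => T1 [] T2.
- apply: (@stuck_grow [:: (e1, a, w1, b); (e2, c, w2, b); (e3, x3, w3, y3)] w1 b) => //.
  + exact: steps3.
  + move=> v; rewrite /st_from /st_to /= addbF bal3.
    by case_eqs v.
  + exact: wB aB T1.
  + move=> Q oth /= [q1 _]; split=> //; apply: (side_const1 closedB lkB _ oth).
      exact: steps3.
    by rewrite /= /st_from /= (negPf aB) (negPf cB) (negPf x3B).
- apply: (@stuck_grow [:: (e1, a, w1, b); (e2, b, w2, c); (e3, x3, w3, y3)] w1 b) => //.
  + exact: steps3.
  + move=> v; rewrite /st_from /st_to /= addbF bal3.
    by case_eqs v.
  + exact: wB aB T1.
  + move=> Q oth /= [q1 _]; split=> //; apply: (side_const1 closedB lkB _ oth).
      exact: steps3.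
    by rewrite /= /st_from /= (negPf aB) bB (negPf x3B).
- apply: (@stuck_grow [:: (e1, b, w1, a); (e2, c, w2, b); (e3, x3, w3, y3)] w2 b) => //.
  + exact: steps3.
  + move=> v; rewrite /st_from /st_to /= addbF bal3.
    by case_eqs v.
  + exact: wB cB T2.
  + move=> Q oth /= [_ [q2 _]]; split=> //; apply: (side_const1 closedB lkB _ oth).
      exact: steps3.
    by rewrite /= /st_from /= (negPf cB) bB (negPf x3B).
(* Both edges keep [b]: the removed pairs of [B] contain [b], so [B :\ b] stays linked and gains [a]
   and [c]. *)
have st : steps o [:: (e1, b, w1, a); (e2, b, w2, c); (e3, x3, w3, y3)].
  exact: steps3.
apply: (@stuck _ (a |: (c |: (B :\ b))) st).
- move=> v; rewrite /st_from /st_to /= addbF bal3.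
  by case_eqs v.
- rewrite !cardsU1 !inE (negPf ac) (negPf aB) (negPf cB) !andbF /=.
  by rewrite (cardsD1 b B) bB.
move=> Q oth /= [q1 [q2 _]].
have QB : {in B :\ b &, forall x y, Q x = Q y}.
  apply: (noncut_const ncb st oth); rewrite /st_from /st_mid /=.
  by rewrite eqxx (negPf x3B); do !split.
have w1B : w1 \in B :\ b.
  by have [_ n _ _ _] := T1; rewrite !inE eq_sym n -(closedB T1).
have w2B : w2 \in B :\ b.
  by have [_ n _ _ _] := T2; rewrite !inE eq_sym n -(closedB T2).
have QE x : x \in a |: (c |: (B :\ b)) -> Q x = Q w1.
  rewrite in_setU1 [x \in c |: _]in_setU1 => /or3P[/eqP->|/eqP->|xB].
  - exact/esym.
  - by rewrite -[Q c]q2; apply: QB.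
  - exact: QB.
by move=> x y /QE-> /QE->.
Qed.

(** * Edges between the two sides: alpha and beta pairs *)

Section TwoSides.

Hypotheses (B1 : 1 < #|B|) (A1 : 1 < #|~: B|).

Let lkA := linkedA B1.

Lemma not_crosses Q e x w y : tr e x w y -> crosses o Q e = false -> Q x = Q w.
Proof. by move=> t; rewrite (triple_crosses _ t); do 2 case: (Q _). Qed.

Lemma card_side_ltT : #|B| < #|[set: V]|.
Proof. by rewrite cardsT -(cardsC B) -[X in X < _]addn0 ltn_add2l ltnW. Qed.

Lemma two_sides_const S Q a b : a \notin S -> b \in S ->
  {in S &, forall x y, Q x = Q y} -> {in ~: S &, forall x y, Q x = Q y} ->
  Q a = Q b -> {in setT &, forall x y, Q x = Q y}.
Proof.
move=> aS bS QS QC Qab.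
have QE x : Q x = Q a.
  have [xS|xS] := boolP (x \in S); first by rewrite Qab; apply: QS.
  by apply: QC; rewrite inE.
by move=> x y _ _; rewrite !QE.
Qed.

(** Losing [b] is affordable: [[set~ b]] is still larger than [B], as [~: B] has at least two
    vertices. *)
Lemma stuck_noncut l b a w : steps o l -> balanced l ->
  a \notin B -> w \in B :\ b ->
  (forall Q, (forall f, f \notin map st_edge l -> crosses o Q f = false) ->
     each (fun t => Q (st_mid t) = Q (st_to t)) l ->
     [/\ {in ~: B &, forall x y, Q x = Q y},
         {in B :\ b &, forall x y, Q x = Q y} & Q a = Q w]) -> False.
Proof.
move=> st bal aB wB H; apply: (@stuck l [set~ b] st bal) => [|Q oth Ql].
  rewrite -(ltn_add2l #|[set b]|) cardsC cards1 -(cardsC B) addnC.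
  by rewrite ltn_add2l.
have [QA QB Qaw] := H Q oth Ql.
have QE x : x != b -> Q x = Q a.
  move=> xb; have [xB|xB] := boolP (x \in B); last by apply: QA; rewrite inE.
  by rewrite Qaw; apply: QB; rewrite // !inE xb.
by move=> x y; rewrite !inE => /QE-> /QE->.
Qed.

(** The closed chain [a b a] removes one pair of [B] and joins [a] to [B] through [w']. *)
Lemma no_alpha_beta e w f w' a b : a \notin B -> b \in B ->
  tr e a w b -> tr f b w' a -> False.
Proof.
move=> aB bB t t'; have ab := side_neq aB bB.
have st : steps o [:: (e, a, w, b); (f, b, w', a)].
  by apply: steps2 => //; apply: triple_neq t t' _; rewrite eq_sym.
apply: (stuck_grow st _ aB bB); first by solve_balanced.
move=> Q oth /= [_ [q _]].
have QB : {in B &, forall x y, Q x = Q y}.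
  apply: (side_const1 closedB lkB st oth).
  by rewrite /= /st_from /= (negPf aB) bB.
by split=> //; rewrite -[Q a]q; apply: QB; rewrite // -(closedB t').
Qed.

Lemma alpha_unique e w f w' a b : a \notin B -> b \in B ->
  tr e a w b -> tr f a w' b -> e = f.
Proof.
move=> aB bB t t'; apply/eqP/negPn/negP => ef.
have st : steps o [:: (e, a, w, b); (f, a, w', b)] by apply: steps2.
have wB : w \notin B by rewrite -(closedB t).
apply: (stuck_grow st _ wB bB); first by solve_balanced.
move=> Q oth /= [q _]; split=> //; apply: (side_const1 closedB lkB st oth).
by rewrite /= /st_from /= (negPf aB).
Qed.

(** The closed chain [a b1 b2 a] removes only [b2 y] from [B] and joins [w1] to [b1]. *)
Lemma alpha_locked e1 w1 e2 w2 f y a b1 b2 : a \notin B ->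
  b1 \in B -> b2 \in B -> b1 != b2 ->
  tr e1 a w1 b1 -> tr e2 a w2 b2 -> tr f b2 y b1 -> False.
Proof.
move=> aB b1B b2B b12 t1 t2 tf.
have fs e w y' : tr e a w y' -> e != f.
  move=> t; apply/eqP => ee; subst f; move: aB.
  have := closedB tf; rewrite b2B => yB.
  by have [[-> _ _]|[-> _ _]] := triple_pair tf t; rewrite ?b2B -?yB.
have st : steps o [:: (e1, a, w1, b1); (e2, a, w2, b2); (f, b2, y, b1)].
  apply: steps3 => //; [exact: triple_neq t1 t2 b12 | exact: fs t1 | exact: fs t2].
have wB : w1 \notin B by rewrite -(closedB t1).
apply: (stuck_grow st _ wB b1B); first by solve_balanced.
move=> Q oth /= [q _]; split=> //; apply: (side_const1 closedB lkB st oth).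
by rewrite /= /st_from /= (negPf aB) b2B.
Qed.

(* Each of the two moves a b_i y fails only if {b1 b2, y z} is a cut with b_i
   and y on different shores; there is only one such cut. *)
Lemma no_fork S e1 w1 e2 w2 f h z a b1 b2 y :
  closed_side o S -> linked o S -> closed_side o (~: S) -> linked o (~: S) ->
  a \notin S -> b1 \in S -> b2 \in S -> y \in S ->
  tr e1 a w1 b1 -> tr e2 a w2 b2 -> tr f b1 b2 y -> tr h y z a -> False.
Proof.
move=> clS lkS clC lkC aS b1S b2S yS.
have key e b w b' Q : tr e a w b -> tr f b b' y -> tr h y z a -> b \in S -> b' \in S ->
    (forall g, g \notin [:: e; f; h] -> crosses o Q g = false) ->
    [/\ Q w = Q b, Q b' = Q y & Q z = Q a] ->
    {in setT &, forall x y, Q x = Q y} \/ (Q b != Q b' /\ Q y != Q z).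
  move=> te tf th bS b'S oth [q1 q2 q3].
  have st : steps o [:: (e, a, w, b); (f, b, b', y); (h, y, z, a)].
    have ay : a != y by apply: contraNneq aS => ->.
    have ab : a != b by apply: contraNneq aS => ->.
    have [_ _ bfy _ _] := tf.
    by apply: steps3 => //; [apply: triple_neq te tf _ | apply: triple_neq te th _
      | apply: triple_neq tf th _]; rewrite // eq_sym.
  have := side_cut vo ev clS st oth.
  rewrite /= /st_from /st_mid /= (negPf aS) bS yS /= addbF => cut.
  have QC : {in ~: S &, forall x y, Q x = Q y}.
    apply: (side_const1 clC lkC st oth).
    by rewrite /= /st_from /= !inE aS bS yS.
  have Qab : Q a = Q b.
    by rewrite -q1; apply: QC; rewrite ?inE // -(clS _ _ _ _ te).
  have [Qbb|Qbb] := eqVneq (Q b) (Q b').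
    have Qyz : Q y = Q z by move: cut; rewrite Qbb addbb; do 2 case: (Q _).
    left; apply: (two_sides_const aS bS) => //.
    apply: (side_const vo clS lkS st oth).
    by rewrite /= /st_from /st_mid /= (negPf aS) Qbb Qyz; do !split.
  by right; split=> //; move: cut Qbb; do 4 case: (Q _).
move=> t1 t2 tf th; have tf' := tripleC tf.
have ab b : b \in S -> a != b by move=> bS; apply: contraNneq aS => ->.
have [_ b12 b1y b2y _] := tf.
have st1 : steps o [:: (e1, a, w1, b1); (f, b1, b2, y); (h, y, z, a)].
  by apply: steps3 => //; [apply: triple_neq t1 tf _ | apply: triple_neq t1 th _
    | apply: triple_neq tf th _]; rewrite // eq_sym ab.
have st2 : steps o [:: (e2, a, w2, b2); (f, b2, b1, y); (h, y, z, a)].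
  by apply: steps3 => //; [apply: triple_neq t2 tf _ | apply: triple_neq t2 th _
    | apply: triple_neq tf th _]; rewrite // eq_sym ab.
apply: (stuck st1 _ card_side_ltT) => [|Q1 oth1 /= [q1 [q2 [q3 _]]]]; first by solve_balanced.
have [//|[n1 m1]] := key _ _ _ _ Q1 t1 tf th b1S b2S oth1 (And3 q1 q2 q3).
exfalso; apply: (stuck st2 _ card_side_ltT) => [|Q2 oth2 /= [r1 [r2 [r3 _]]]].
  by solve_balanced.
have [//|[n2 m2]] := key _ _ _ _ Q2 t2 tf' th b2S b1S oth2 (And3 r1 r2 r3).
(* [Q1] and [Q2] separate the same two pairs inside [S], so their sum is constant on [S]; yet it
   differs at [b1] and [y]. *)
exfalso; have QS : {in S &, forall x y, Q1 x (+) Q2 x = Q1 y (+) Q2 y}.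
  apply: (side_local clS lkS) => e x w u t xS.
  have [ef|ef] := eqVneq e f.
    subst e; move: n1 n2; have [[-> -> _]|[-> -> _]] := triple_pair tf t;
    by case_values Q1; case_values Q2.
  have [eh|eh] := eqVneq e h.
    subst e; move: m1 m2; have [[-> -> _]|[-> -> _]] := triple_pair th t;
    by case_values Q1; case_values Q2.
  have out e' w' b' : tr e' a w' b' -> e != e'.
    move=> t'; apply: contraNneq aS => ee; subst e'.
    by have [[-> _ _]|[-> _ _]] := triple_pair t t'; rewrite -?(clS _ _ _ _ t).
  congr (_ (+) _); apply: (not_crosses t).
    by apply: oth1; rewrite /= !inE (negPf ef) (negPf eh) (negPf (out _ _ _ t1)).
  by apply: oth2; rewrite /= !inE (negPf ef) (negPf eh) (negPf (out _ _ _ t2)).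
have := QS b1 y b1S yS; move: q2 r2 n1 n2; rewrite /st_mid /st_to /= => -> ->.
by case_values Q1; case_values Q2.
Qed.

(** An edge through [b1] and [b2] omits neither by [alpha_locked]. If it omits some [y] in [B],
    either [a] is alpha at [y], against [alpha_locked], or beta, against [no_fork]. *)
Lemma alpha_pair e1 w1 e2 w2 a b1 b2 : a \notin B ->
  b1 \in B -> b2 \in B -> b1 != b2 -> tr e1 a w1 b1 -> tr e2 a w2 b2 ->
  exists f y, y \notin B /\ tr f b1 b2 y.
Proof.
move=> aB b1B b2B b12 t1 t2; have b21 : b2 != b1 by rewrite eq_sym.
have [f [y [tf|tf|tf]]] := cover_triple vo b12; last 1 first.
- by case: (alpha_locked aB b1B b2B b12 t1 t2 tf).
- exists f, y; split=> //; apply/negP => yB.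
  have [_ _ b1y _ _] := tf; rewrite eq_sym in b1y.
  have [e3 [w3 [t3|t3]]] := alpha_beta aB yB.
    exact: alpha_locked aB yB b1B b1y t3 t1 tf.
  exact: (no_fork closedB lkB closedA lkA aB b1B b2B yB t1 t2 tf t3).
- by case: (alpha_locked aB b2B b1B b21 t2 t1 tf).
Qed.

Lemma sideC a : a \notin B -> a \in ~: B. Proof. by rewrite inE. Qed.

Lemma beta_mid b e w a : b \in B -> tr e b w a -> w \in B :\ b.
Proof.
by move=> bB t; have [_ bw _ _ _] := t; rewrite !inE eq_sym bw -(closedB t).
Qed.

(** Both removed pairs of [B] contain [b], so [B :\ b] stays connected and is joined to [a] through
    [w]. *)
Lemma beta_unique b e w f w' a : noncut b -> a \notin B ->
  tr e b w a -> tr f b w' a -> e = f.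
Proof.
move=> ncb aB t t'; apply/eqP/negPn/negP => ef; have [bB _] := ncb.
have st : steps o [:: (e, b, w, a); (f, b, w', a)] by apply: steps2.
apply: (stuck_noncut st _ aB (beta_mid bB t)); first by solve_balanced.
move=> Q oth /= [q _]; split=> //.
  apply: (side_const1 closedA lkA st oth).
  by rewrite /= /st_from /= !inE bB.
by apply: (noncut_const ncb st oth); rewrite /st_from /= eqxx; do !split.
Qed.

Lemma beta_locked b e1 w1 e2 w2 f y a1 a2 : noncut b ->
  a1 \notin B -> a2 \notin B -> a1 != a2 ->
  tr e1 b w1 a1 -> tr e2 b w2 a2 -> tr f a2 y a1 -> False.
Proof.
move=> ncb a1B a2B a12 t1 t2 tf; have [bB _] := ncb.
have fs e w y' : tr e b w y' -> e != f.
  move=> t; apply/eqP => ee; subst f; move: bB.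
  have := closedB tf; rewrite (negPf a2B) => yB.
  by have [[-> _ _]|[-> _ _]] := triple_pair tf t; rewrite ?(negPf a2B) -?yB.
have st : steps o [:: (e1, b, w1, a1); (e2, b, w2, a2); (f, a2, y, a1)].
  apply: steps3 => //; [exact: triple_neq t1 t2 a12 | exact: fs t1 | exact: fs t2].
apply: (stuck_noncut st _ a1B (beta_mid bB t1)); first by solve_balanced.
move=> Q oth /= [q _]; split=> //.
  apply: (side_const1 closedA lkA st oth).
  by rewrite /= /st_from /= !inE bB a2B.
apply: (noncut_const ncb st oth); rewrite /st_from /= eqxx (negPf a2B).
by do !split.
Qed.

(** Parallel to [alpha_pair], with [beta_locked] for [alpha_locked] and [no_fork] applied to the
    side [~: B]. *)
Lemma beta_pair b e1 w1 e2 w2 a1 a2 : noncut b ->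
  a1 \notin B -> a2 \notin B -> a1 != a2 -> tr e1 b w1 a1 -> tr e2 b w2 a2 ->
  exists f y, y \in B /\ tr f a1 a2 y.
Proof.
move=> ncb a1B a2B a12 t1 t2; have a21 : a2 != a1 by rewrite eq_sym.
have [bB _] := ncb.
have [f [y [tf|tf|tf]]] := cover_triple vo a12; last 1 first.
- by case: (beta_locked ncb a1B a2B a12 t1 t2 tf).
- exists f, y; split=> //; apply/negPn/negP => yB.
  have [_ _ a1y _ _] := tf; rewrite eq_sym in a1y.
  have [e3 [w3 [t3|t3]]] := alpha_beta yB bB.
    have bA : b \notin ~: B by rewrite inE bB.
    apply: (no_fork closedA lkA _ _ bA (sideC a1B) (sideC a2B) (sideC yB) t1 t2 tf t3).
      by rewrite setCK; apply: closedB.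
    by rewrite setCK.
  exact: beta_locked ncb yB a1B a1y t3 t1 tf.
- by case: (beta_locked ncb a2B a1B a21 t2 t1 tf).
Qed.

(** On distinct edges the closed chain [a b a' b' a] would remove only [b y] from [B] and join [w1]
    to [b]; the omitted vertices distinguish all the edges except [h] and [e2]. *)
Lemma no_alpha_cycle e1 w1 g y h s e2 w a a' b b' :
  a \notin B -> a' \notin B -> b \in B -> b' \in B -> a != a' -> b != b' ->
  tr e1 a w1 b -> tr g b y a' -> tr h a' s b' -> tr e2 a w b' -> h = e2.
Proof.
move=> aB a'B bB b'B aa bb t1 tg th t2; apply/eqP/negPn/negP => he.
have st : steps o [:: (e1, a, w1, b); (g, b, y, a'); (h, a', s, b'); (e2, a, w, b')].
  have b'a : b' != a' by rewrite eq_sym side_neq.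
  apply: steps4 => //; [apply: triple_neq t1 tg _ | apply: triple_neq t1 th _
    | apply: triple_neq t1 t2 _ | apply: triple_neq tg th _
    | apply: triple_neq tg t2 _]; solve_neq.
have wB : w1 \notin B by rewrite -(closedB t1).
apply: (stuck_grow st _ wB bB); first by solve_balanced.
move=> Q oth /= [q _]; split=> //; apply: (side_const1 closedB lkB st oth).
by rewrite /= /st_from /= (negPf aB) (negPf a'B) bB.
Qed.

Lemma no_beta_cycle e1 y1 g y h s e2 w a a' b b' : noncut b ->
  a \notin B -> a' \notin B -> b' \in B -> a != a' -> b != b' ->
  tr e1 b y1 a -> tr g a y b' -> tr h b' s a' -> tr e2 b w a' -> h = e2.
Proof.
move=> ncb aB a'B b'B aa bb t1 tg th t2; apply/eqP/negPn/negP => he.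
have [bB _] := ncb.
have st : steps o [:: (e1, b, y1, a); (g, a, y, b'); (h, b', s, a'); (e2, b, w, a')].
  have b'a := side_neq a'B b'B.
  apply: steps4 => //; [apply: triple_neq t1 tg _ | apply: triple_neq t1 th _
    | apply: triple_neq t1 t2 _ | apply: triple_neq tg th _
    | apply: triple_neq tg t2 _]; solve_neq.
apply: (stuck_noncut st _ aB (beta_mid bB t1)); first by solve_balanced.
move=> Q oth /= [q1 [q2 [q3 [q4 _]]]].
have QA : {in ~: B &, forall x y, Q x = Q y}.
  apply: (side_const1 closedA lkA st oth).
  by rewrite /= /st_from /= !inE bB b'B aB.
(* The removed pair [b' s] may avoid [b], but its ends stay connected through [~: B]: new pairs join
   [b'] to [y] and [s] to [a']. *)
have Qbs : Q b' = Q s.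
  by rewrite -[Q b']q2 [RHS]q3; apply: QA; rewrite inE // -(closedB tg).
split=> //; apply: (noncut_const ncb st oth).
by rewrite /st_from /st_mid /= eqxx (negPf aB) Qbs; do !split.
Qed.

(** The closed chain [b a' x a b] removes two pairs from each side. It can leave the graph
    disconnected only when both removed pairs of [~: B] are separated, with [a] and [a'] on the same
    shore; the last hypothesis refutes this case. *)
Lemma diagonal e2 w g y h z e1 y1 a a' b x :
  a \notin B -> a' \notin B -> b \in B -> x \in B -> a != a' -> b != x ->
  tr e2 b w a' -> tr g a' y x -> tr h x z a -> tr e1 a y1 b ->
  (forall Q, (forall f, f \notin [:: e2; g; h; e1] -> crosses o Q f = false) ->
     Q a' != Q y -> Q a != Q y1 -> Q a = Q a' -> False) -> False.
Proof.
move=> aB a'B bB xB aa bx t2 tg th t1 H.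
have st : steps o [:: (e2, b, w, a'); (g, a', y, x); (h, x, z, a); (e1, a, y1, b)].
  apply: steps4 => //; [apply: triple_neq t2 tg _ | apply: triple_neq t2 th _
    | apply: triple_neq t2 t1 _ | apply: triple_neq tg th _
    | apply: triple_neq tg t1 _ | apply: triple_neq th t1 _]; solve_neq.
apply: (stuck st _ card_side_ltT); first by solve_balanced.
move=> Q oth /= [q1 [q2 [q3 [q4 _]]]].
have := side_cut vo ev closedA st oth.
rewrite /= /st_from /st_mid /= !inE aB a'B bB xB /= !addbF => cutA.
have cB : Q b = Q w -> Q x = Q z -> {in B &, forall x y, Q x = Q y}.
  move=> qb qx; apply: (side_const vo closedB lkB st oth).
  by rewrite /= /st_from /st_mid /= (negPf aB) (negPf a'B); do !split.
have cA : Q a' = Q y -> Q a = Q y1 -> {in ~: B &, forall x y, Q x = Q y}.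
  move=> qb qx; apply: (side_const vo closedA lkA st oth).
  by rewrite /= /st_from /st_mid /= !inE bB xB; do !split.
rewrite /st_mid /st_to /= in q1 q2 q3 q4.
have [Qay|Qay] := eqVneq (Q a') (Q y).
  have Qay1 : Q a = Q y1 by move: cutA; rewrite Qay addbb; do 2 case: (Q _).
  have QA := cA Qay Qay1; have Qaa : Q a = Q a' by apply: QA; rewrite inE.
  apply: (two_sides_const aB bB _ QA); last by rewrite -q4.
  by apply: cB; rewrite -?q2 ?q1 ?q3 -?q4 -?Qay -?Qay1.
have Qay1 : Q a != Q y1 by move: cutA Qay; do 4 case: (Q _).
have [Qbw|Qbw] := eqVneq (Q b) (Q w); last first.
  exfalso; apply: (H Q oth Qay Qay1); move: Qbw Qay1; rewrite q1 -q4.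
  by do 3 case: (Q _).
exfalso; move: (cB Qbw) (Qbw); rewrite -q4 q1 => {}cB Qya.
have Qxz : Q x = Q z.
  by rewrite q3 -q2; move: Qay1 Qay; rewrite Qya; do 3 case: (Q _).
by move: (cB Qxz b x bB xB) Qay; rewrite -q4 -q2 Qya => ->; rewrite eqxx.
Qed.

(** An edge keeping [y y'] and omitting some [x] in [B] gives one [diagonal] chain through [y] and
    another through [y']. *)
Lemma alpha_two_betas e1 y1 e2 w e2' w' a y y' b : noncut b ->
  a \notin B -> y \notin B -> y' \notin B -> y != y' ->
  tr e1 a y1 b -> tr e2 b w y -> tr e2' b w' y' -> False.
Proof.
move=> ncb aB yB y'B yy t1 t2 t2'; have [bB _] := ncb.
have [f [x [xB tf]]] := beta_pair ncb yB y'B yy t2 t2'.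
have ay : a != y by apply/eqP => ay; subst y; apply: no_alpha_beta aB bB t1 t2.
have ay' : a != y' by apply/eqP => ay'; subst y'; apply: no_alpha_beta aB bB t1 t2'.
have bx : b != x.
  by apply/eqP => bx; subst x; apply: no_alpha_beta yB bB tf t2.
have [h [z [th|th]]] := alpha_beta aB xB.
  have fh := no_alpha_cycle aB yB bB xB ay bx t1 t2 tf th; subst h.
  by have [[ea _ _]|[ea _ _]] := triple_pair tf th; subst a; rewrite eqxx in ay ay'.
apply: (diagonal aB yB bB xB ay bx t2 tf th t1) => Q1 oth1 m1 n1 k1.
apply: (diagonal aB y'B bB xB ay' bx t2' (tripleC tf) th t1) => Q2 oth2 m2 n2 k2.
(* Both colourings separate exactly the pairs [y y'] and [a y1] of [~: B], so their sum is constant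
   there; yet it differs at [a] and [y]. *)
have QA : {in ~: B &, forall x y, Q1 x (+) Q2 x = Q1 y (+) Q2 y}.
  apply: (side_local closedA lkA) => e u v r t; rewrite inE => uB.
  have [ef|ef] := eqVneq e f.
    subst e; move: m1 m2; have [[-> -> _]|[-> -> _]] := triple_pair tf t;
    by case_values Q1; case_values Q2.
  have [eh|eh] := eqVneq e e1.
    subst e; move: n1 n2; have [[-> -> _]|[-> -> _]] := triple_pair t1 t;
    by case_values Q1; case_values Q2.
  have out e' c w3 b' : c \in B -> tr e' c w3 b' -> e != e'.
    move=> cB t'; apply: contraTneq cB => ee; subst e'.
    by have [[-> _ _]|[-> _ _]] := triple_pair t t'; rewrite -?(closedB t).
  have nh := out _ _ _ _ xB th.
  congr (_ (+) _); apply: (not_crosses t).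
    apply: oth1; rewrite /= !inE (negPf ef) (negPf eh) (negPf nh).
    by rewrite (negPf (out _ _ _ _ bB t2)).
  apply: oth2; rewrite /= !inE (negPf ef) (negPf eh) (negPf nh).
  by rewrite (negPf (out _ _ _ _ bB t2')).
have := QA a y (sideC aB) (sideC yB); rewrite k1 k2; move: m2.
by case_values Q1; case_values Q2.
Qed.

(** * Sizes of the two sides *)

(** If only [a] and [a'] lay outside [B], at least two edges would keep [a a'], by linkedness and
    the absence of bridges. They omit distinct vertices of [B], and [alpha_pair] gives an edge
    contradicting [no_alpha_beta]. *)
Lemma small_side_gt2 : 2 < #|~: B|.
Proof.
rewrite ltn_neqAle A1 andbT eq_sym; apply/negP => /cards2P[a [a' [aa AE]]].
have inA v : (v \in B) = ~~ ((v == a) || (v == a')).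
  by apply: negb_inj; rewrite -in_setC AE !inE negbK.
have aB : a \notin B by rewrite inA eqxx.
have a'B : a' \notin B by rewrite inA eqxx orbT.
have trA e x w y : tr e x w y -> x \notin B -> tr e a a' y.
  move=> t xB; have wB : w \notin B by rewrite -(closedB t).
  have [_ xw _ _ _] := t; move: xB wB; rewrite !inA !negbK.
  move=> /orP[]/eqP ex /orP[]/eqP ew; subst x w; rewrite ?eqxx // in xw *.
  exact: tripleC.
have yB e y : tr e a a' y -> y \in B.
  by case=> _ _ ay a'y _; rewrite inA !(eq_sym y) negb_or ay.
have noconst : ~ {in ~: B &, forall x y, (x == a) = (y == a)}.
  by move/(_ a a' (sideC aB) (sideC a'B)); rewrite eqxx (eq_sym a') (negPf aa).
have cross0 l : (forall f y, tr f a a' y -> f \in map st_edge l) ->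
    forall f, f \notin map st_edge l -> crosses o (fun v => v == a) f = false.
  move=> H f fl; have [x [w t]] := triple_ex f vo.
  have [xB|xB] := boolP (x \in B); last first.
    by rewrite (H f (o f)) // in fl; apply: trA t xB.
  rewrite (triple_crosses _ t) [x == a]eq_sym [w == a]eq_sym.
  by rewrite (negPf (side_neq aB xB)) (negPf (side_neq aB _)) // -(closedB t).
have [e [y t]] : exists e y, tr e a a' y.
  apply: NNPP => H; apply: noconst.
  apply: (@side_const1 _ [::] _ closedA lkA) => //; apply: cross0 => f y t.
  by case: H; exists f, y.
have [e' [y' [t' ee]]] : exists e' y', tr e' a a' y' /\ e <> e'.
  apply: NNPP => H; apply: noconst.
  apply: (@side_const1 _ [:: (e, a, a', y)] _ closedA lkA) => //=.
    apply: (cross0 [:: (e, a, a', y)]) => f y' t'; rewrite inE; apply/eqP.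
    by apply: NNPP => ef; apply: H; exists f, y'; split=> // /esym.
  by case: (_ \in _).
have yy : y != y'.
  by apply/eqP => yy; subst y'; apply: ee; apply: alpha_unique aB (yB _ _ t) t t'.
have [f [z [zB tf]]] := alpha_pair aB (yB _ _ t) (yB _ _ t') yy t t'.
move: zB; rewrite inA negbK => /orP[/eqP ez|/eqP ez]; subst z.
  exact: no_alpha_beta aB (yB _ _ t) t tf.
exact: no_alpha_beta a'B (yB _ _ t) (tripleC t) tf.
Qed.

(** Otherwise [b] is beta for three vertices, giving edges that keep [a1 a2] and [a1 a3] and omit
    [x12] and [x13]. An edge keeping [x12 x13] then completes a chain excluded by
    [no_beta_cycle]. *)
Lemma noncut_alpha b : noncut b -> exists a e w, a \notin B /\ tr e a w b.
Proof.
move=> ncb; apply: NNPP => H; have [bB _] := ncb.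
have beta a : a \notin B -> exists e w, tr e b w a.
  move=> aB; have [e [w [t|t]]] := alpha_beta aB bB; last by exists e, w.
  by case: H; exists a, e, w.
have /card_gt2P[a1 [a2 [a3 [[]]]]] := small_side_gt2.
rewrite !inE => a1B a2B a3B [a12 a23 a31].
have [e1 [w1 t1]] := beta _ a1B; have [e2 [w2 t2]] := beta _ a2B.
have [e3 [w3 t3]] := beta _ a3B.
have [f12 [x12 [x12B tf12]]] := beta_pair ncb a1B a2B a12 t1 t2.
have a13 : a1 != a3 by rewrite eq_sym.
have [f13 [x13 [x13B tf13]]] := beta_pair ncb a1B a3B a13 t1 t3.
have xx : x12 != x13.
  apply/eqP => xx; subst x13.
  have ff := alpha_unique a1B x12B tf12 tf13; subst f13.
  have [[_ ea _]|[ea _ _]] := triple_pair tf12 tf13; subst.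
    by rewrite eqxx in a23.
  by rewrite eqxx in a12.
have nb f w x : tr f a1 w x -> b != x.
  by move=> t; apply/eqP => bx; subst x; apply: no_alpha_beta a1B bB t t1.
have [k [y [yB tk]]] := alpha_pair a1B x12B x13B xx tf12 tf13.
have [e [w t]] := beta _ yB.
have ay : a1 != y.
  by apply/eqP => ay; subst y; apply: no_alpha_beta a1B x12B tf12 tk.
have ke := no_beta_cycle ncb a1B yB x12B ay (nb _ _ _ tf12) t1 tf12 tk t; subst k.
have [[eb _ _]|[eb _ _]] := triple_pair tk t.
  by have := nb _ _ _ tf12; rewrite eb eqxx.
by have := nb _ _ _ tf13; rewrite eb eqxx.
Qed.

Lemma noncut_beta_unique b a a' e w e' w' : noncut b ->
  a \notin B -> a' \notin B -> tr e b w a -> tr e' b w' a' -> a = a'.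
Proof.
move=> ncb aB a'B t t'; apply/eqP/negPn/negP => aa.
have [c [f [u [cB tf]]]] := noncut_alpha ncb.
exact: alpha_two_betas ncb cB aB a'B aa tf t t'.
Qed.

(** Pigeonhole: of three vertices outside [B], at most one is beta at [b] and at most one at [b'],
    so one is alpha at both and [alpha_pair] applies. *)
Lemma noncut_adjacent b b' : noncut b -> noncut b' -> b != b' ->
  exists f y, y \notin B /\ tr f b b' y.
Proof.
move=> ncb ncb' bb; have [bB _] := ncb; have [b'B _] := ncb'.
have /card_gt2P[a1 [a2 [a3 [[]]]]] := small_side_gt2.
rewrite !inE => a1B a2B a3B [a12 a23 a31].
have key a : a \notin B -> (exists f y, y \notin B /\ tr f b b' y) \/
    (exists e w, tr e b w a) \/ (exists e w, tr e b' w a).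
  move=> aB; have [e [w [t|t]]] := alpha_beta aB bB; last by right; left; exists e, w.
  have [e' [w' [t'|t']]] := alpha_beta aB b'B; last by right; right; exists e', w'.
  by left; apply: alpha_pair aB bB b'B bb t t'.
have [//|K1] := key a1 a1B; have [//|K2] := key a2 a2B; have [//|K3] := key a3 a3B.
have un a a' c : noncut c -> a \notin B -> a' \notin B -> a != a' ->
    (exists e w, tr e c w a) -> (exists e w, tr e c w a') -> False.
  move=> ncc aB a'B aa [e [w t]] [e' [w' t']].
  by rewrite (noncut_beta_unique ncc aB a'B t t') eqxx in aa.
by case: K1 K2 K3 => K1 [] K2 [] K3; exfalso;
  [apply: un a12 K1 K2 | apply: un a12 K1 K2 | apply: un a31 K3 K1
  |apply: un a23 K2 K3 | apply: un a23 K2 K3 | apply: un a31 K3 K1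
  |apply: un a12 K1 K2 | apply: un a12 K1 K2].
Qed.

Lemma large_side_small : #|B| <= 2.
Proof.
rewrite leqNgt; apply/negP => B2.
have [all|[b [b' [nb nb' bb no]]]] := all_noncut_or_nonadjacent; last first.
  by have [f [y [_ /no]]] := noncut_adjacent nb nb' bb.
have /card_gt2P[b1 [b2 [b3 [[b1B b2B b3B] [b12 b23 b31]]]]] := B2.
have b13 : b1 != b3 by rewrite eq_sym.
have [f [y [yB t]]] := noncut_adjacent (all _ b1B) (all _ b2B) b12.
have [f' [y' [yB' t']]] := noncut_adjacent (all _ b1B) (all _ b3B) b13.
have yy := noncut_beta_unique (all _ b1B) yB yB' t t'; subst y'.
have ff := beta_unique (all _ b1B) yB t t'; subst f'.
have [[_ eb _]|[eb _ _]] := triple_pair t t'; subst.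
  by rewrite eqxx in b23.
by rewrite eqxx in b12.
Qed.

End TwoSides.

(** Otherwise [~: B] contains a kept pair and is linked, so its size is at most [#|B| <= 2]. *)
Lemma maximal_covers : 1 < #|B| -> 4 < #|V| -> forall e x, inc o e x -> x \in B.
Proof.
move=> B1 V5 e x ex; apply/negPn/negP => xB.
have [u [w t]] := triple_ex e vo; have [_ uw _ _ _] := t.
have [uB wB] : u \notin B /\ w \notin B.
  move: ex; rewrite (triple_inc _ t) => /orP[]/eqP xu; subst x.
    by rewrite -(closedB t).
  by rewrite (closedB t).
have A1 : 1 < #|~: B| by apply/card_gt1P; exists u, w; rewrite !inE.
have := maxB vo ev (linkedA B1); have B2 := large_side_small B1 A1.
move=> AB; move: V5; rewrite -(cardsC B) ltnNge.
by rewrite (leq_add B2 (leq_trans AB B2)).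
Qed.

End Maximal.

Lemma exists_maximal_linked : 4 < #|V| ->
  (exists o, valid o /\ even_omission o) -> (exists e : E, True) ->
  exists o B, [/\ valid o, even_omission o, linked o B &
    forall e x, inc o e x -> x \in B].
Proof.
move=> V5 [o0 [vo0 ev0]] [e _].
suff [o [B [vo ev lk B1 max]]] : exists o B, [/\ valid o, even_omission o,
    linked o B, 1 < #|B| & forall o' S, valid o' -> even_omission o' ->
    linked o' S -> #|S| <= #|B|].
  by exists o, B; split=> //; apply: maximal_covers.
have [x [w t]] := triple_ex e vo0; have [_ xw _ _ _] := t.
have lk0 : linked o0 [set x; w].
  move=> Q Q0; have Qxw : Q x = Q w.
    by have := Q0 e; rewrite (triple_crosses _ t); do 2 case: (Q _).
  by move=> u v; rewrite !inE => /orP[]/eqP-> /orP[]/eqP->; rewrite ?Qxw.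
have: 1 < #|[set x; w]| by rewrite cards2 xw.
have [n] := ubnP (#|V| - #|[set x; w]|); move: {x w xw t} [set x; w] lk0 => B.
elim: n o0 B vo0 ev0 => // n IH o B vo ev lk ltn B1.
case: (classic (exists o' S, [/\ valid o', even_omission o', linked o' S &
    #|B| < #|S|])) => [[o' [S [vo' ev' lk' BS]]]|H].
  apply: (IH o' S) => //; last exact: ltn_trans BS.
  rewrite ltnS in ltn; apply: leq_trans ltn.
  by rewrite ltn_sub2l // (leq_trans BS) ?max_card.
exists o, B; split=> // o' S vo' ev' lk'; rewrite leqNgt; apply/negP => BS.
by apply: H; exists o', S.
Qed.

(** * Correcting the parities of two odd vertices *)

Section Repair.

Variables (o : E -> V) (e : E).
Hypothesis vo : valid o.

Local Notation tr := (triple o).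

(* The steps l change the parities of exactly p and q. *)
Definition shift l p q := steps o l /\ forall x,
  foldr (fun t b => (st_from t == x) (+) (st_to t == x) (+) b) false l
  = (p == x) (+) (q == x).

(** The edge [e] is spared so that a step on it can still be added to the chain. *)
Definition connects p q := exists l, shift l p q /\ e \notin map st_edge l.

(** [f] omits one of [p] and [x]; omitting the other one instead changes the parities of just these
    two. *)
Definition toggles f p x :=
  [&& f != e, p \in ends f, x \in ends f & (o f == p) || (o f == x)].

Lemma toggles_step f p x : p != x -> toggles f p x ->
  exists a b y, tr f a y b /\ forall v, (a == v) (+) (b == v) = (p == v) (+) (x == v).
Proof.
move=> px /and4P[_ pf xf po]; have [a [b t]] := triple_ex f vo.
have [ee _ _ _ _] := t.
move: pf xf px po; rewrite ee !inE -!orbA.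
move=> /or3P[]/eqP-> /or3P[]/eqP->; rewrite ?eqxx // => ab H.
- by have [_ _ ao bo _] := t; move: H; rewrite 2!(eq_sym (o f)) (negPf ao) (negPf bo).
- by exists a, (o f), b.
- by have [_ _ ao bo _] := t; move: H; rewrite 2!(eq_sym (o f)) (negPf ao) (negPf bo).
- by exists b, (o f), a; split=> //; apply: tripleC.
- by exists a, (o f), b; split=> // v; rewrite addbC.
- by exists b, (o f), a; split=> // [|v]; [apply: tripleC | rewrite addbC].
Qed.

Lemma connects1 f p x : p != x -> toggles f p x -> connects p x.
Proof.
move=> px H; have [a [b [y [t bal]]]] := toggles_step px H.
exists [:: (f, a, y, b)]; split; [split=> //= v|]; first by rewrite addbF bal.
by rewrite inE eq_sym; case/and4P: H.
Qed.

Lemma connects2 f g p x q : p != x -> x != q -> f != g ->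
  toggles f p x -> toggles g x q -> connects p q.
Proof.
move=> px xq fg H1 H2; have [a1 [b1 [y1 [t1 bal1]]]] := toggles_step px H1.
have [a2 [b2 [y2 [t2 bal2]]]] := toggles_step xq H2.
exists [:: (f, a1, y1, b1); (g, a2, y2, b2)]; split; last first.
  by rewrite /= !inE !(eq_sym e) negb_or; case/and4P: H1 => ->; case/and4P: H2 => ->.
split=> [|v]; first by split; rewrite //= inE.
by rewrite /= /st_from /st_to /= addbF bal1 bal2; case_eqs v.
Qed.

Lemma connects3 f g h p x y q : p != x -> x != y -> y != q ->
  f != g -> f != h -> g != h ->
  toggles f p x -> toggles g x y -> toggles h y q -> connects p q.
Proof.
move=> px xy yq fg fh gh H1 H2 H3.
have [a1 [b1 [y1 [t1 bal1]]]] := toggles_step px H1.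
have [a2 [b2 [y2 [t2 bal2]]]] := toggles_step xy H2.
have [a3 [b3 [y3 [t3 bal3]]]] := toggles_step yq H3.
exists [:: (f, a1, y1, b1); (g, a2, y2, b2); (h, a3, y3, b3)]; split; last first.
  rewrite /= !inE !(eq_sym e) !negb_or.
  by case/and4P: H1 => ->; case/and4P: H2 => ->; case/and4P: H3 => ->.
split=> [|v]; first by split; rewrite //= !inE ?negb_or ?fg //; split; rewrite //= inE.
by rewrite /= /st_from /st_to /= addbF bal1 bal2 bal3; case_eqs v.
Qed.

Lemma tripleI f p x : p \in ends f -> x \in ends f ->
  p != x -> p != o f -> x != o f -> tr f p x (o f).
Proof.
move=> pf xf px po xo; have [a [b t]] := triple_ex f vo.
have: inc o f p && inc o f x by rewrite /inc pf xf !(eq_sym (o f)) po xo.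
rewrite !(triple_inc _ t) => /andP[/orP[]/eqP ep /orP[]/eqP ex]; subst p x;
  by rewrite ?eqxx // in px *; apply: tripleC.
Qed.

Hypothesis stuck_e : forall p q,
  p \in ends e -> q \in ends e -> p != q -> ~ connects p q.

Definition near p x := [exists f, toggles f p x].

Definition only_near p := [set y | [&& y \notin ends e, near p y &
  [forall q in ends e, (q != p) ==> ~~ near q y]]].

Definition joins p x y :=
  [exists f, [&& f != e, p \in ends f, x \in ends f & o f == y]].

(** Different edges would form a chain [p x q] avoiding [e]. *)
Lemma near_unique p q x f g : p \in ends e -> q \in ends e -> p != q ->
  x \notin ends e -> toggles f p x -> toggles g q x -> f = g.
Proof.
move=> pe qe pq xe H1 H2; apply/eqP/negPn/negP => fg.
have px : p != x by apply: contraNneq xe => <-.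
have xq : x != q by apply: contraNneq xe => ->.
apply: (stuck_e pe qe pq); apply: (connects2 px xq fg H1).
by case/and4P: H2 => g1 g2 g3 g4; rewrite /toggles g1 g2 g3 orbC.
Qed.

(** An edge through [p] and [x] must keep both, so it makes its omitted vertex [y] near [p]; by
    [near_unique], [y] is near no other vertex of [e]. *)
Lemma not_near_joins p x : p \in ends e -> x \notin ends e -> ~~ near p x ->
  exists y, [/\ y \in only_near p, joins p x y & x != y].
Proof.
move=> pe xe npx; have px : p != x by apply: contraNneq xe => <-.
have inE' f a w b : tr f a w b -> [/\ a \in ends f, w \in ends f, b \in ends f & o f = b].
  by case=> -> _ _ _ ->; rewrite !inE !eqxx !orbT.
have xe' f : x \in ends f -> f != e by apply: contraTneq => ->.
have [f [y [t|t|t]]] := cover_triple vo px; have [i1 i2 i3 oy] := inE' _ _ _ _ t.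
- have [_ _ py xy _] := t; exists y; split=> //; last first.
    by apply/existsP; exists f; rewrite xe' // i1 i2 oy eqxx.
  have tpy : toggles f p y by rewrite /toggles xe' // i1 i3 oy eqxx orbT.
  have ye : y \notin ends e.
    by apply/negP => ye; apply: (stuck_e pe ye py); apply: connects1 tpy.
  rewrite inE ye /=; apply/andP; split; first by apply/existsP; exists f.
  apply/forall_inP => q qe; apply/implyP => qp; apply/negP => /existsP[g tg].
  have pq : p != q by rewrite eq_sym.
  have fg := near_unique pe qe pq ye tpy tg; subst g.
  have [ee _ _ _ _] := t; have /and4P[_ qf _ _] := tg.
  move: qf; rewrite ee !inE (negPf qp) /= => /orP[]/eqP eq; subst q.
    by rewrite qe in xe.
  by rewrite qe in ye.
- by case/negP: npx; apply/existsP; exists f; rewrite /toggles xe' // i1 i3 oy eqxx orbT.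
- by case/negP: npx; apply/existsP; exists f; rewrite /toggles xe' // i1 i3 oy eqxx.
Qed.

(* If two vertices x, x' of only_near q were joined to p through the same y,
   then q x y p would be a chain of toggles on distinct edges. *)
Lemma joins_inj p q x x' y : p \in ends e -> q \in ends e -> p != q ->
  x \notin ends e -> x' \notin ends e -> y \notin ends e -> x != y -> x' != y ->
  near q x -> joins p x y -> joins p x' y -> x = x'.
Proof.
move=> pe qe pq xe x'e ye xy x'y /existsP[g tg].
case/existsP=> f /and4P[fe pf xf /eqP of1] /existsP[f' /and4P[fe' pf' xf' /eqP of2]].
apply/eqP/negPn/negP => xx.
have out z z' : z \in ends e -> z' \notin ends e -> z != z'.
  by move=> ze; apply: contraNneq => <-.
have t : tr f p x y by rewrite -of1; apply: tripleI; rewrite ?of1 // out.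
have t' : tr f' p x' y by rewrite -of2; apply: tripleI; rewrite ?of2 // out.
have qf h z : tr h p z y -> z \notin ends e -> q \notin ends h.
  case=> -> _ _ _ _ ze; rewrite !inE !negb_or eq_sym pq.
  by rewrite !out.
have gh h z : tr h p z y -> z \notin ends e -> g != h.
  move=> th ze; apply: contraTneq (qf _ _ th ze) => <-.
  by case/and4P: tg => _ -> _ _.
have qp : q != p by rewrite eq_sym.
have yp : y != p by rewrite eq_sym out.
apply: (stuck_e qe pe qp).
apply: (@connects3 g f f' q x y p) => //; first exact: out.
- exact: gh t xe.
- exact: gh t' x'e.
- apply/eqP => ff; subst f'; have [[_ ex _]|[ex _ _]] := triple_pair t t'.
    by rewrite ex eqxx in xx.
  by rewrite -ex pe in xe.
- by rewrite /toggles fe xf of1 eqxx orbT andbT -{1}of1 vo.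
by rewrite /toggles fe' pf' of2 eqxx /= andbT -{1}of2 vo.
Qed.

(** Vertices near only [q] or only [r] are not near [p], so [not_near_joins] maps them into
    [only_near p], injectively by [joins_inj]. *)
Lemma card_only_near p q r : p \in ends e -> q \in ends e -> r \in ends e ->
  p != q -> p != r -> q != r ->
  #|only_near q| + #|only_near r| <= #|only_near p|.
Proof.
move=> pe qe re pq pr qr.
have far z y : z \in ends e -> y \in only_near z ->
    [/\ y \notin ends e, near z y & forall z', z' \in ends e -> z' != z -> ~~ near z' y].
  move=> ze; rewrite inE => /and3P[ye ny /forall_inP H]; split=> // z' ze' zz.
  exact: (implyP (H z' ze')).
have dis : [disjoint only_near q & only_near r].
  apply/pred0P => y /=; apply/andP => -[/(far _ _ qe)[_ nq _] /(far _ _ re)[_ _ H]].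
  by have := H q qe qr; rewrite nq.
have -> : #|only_near q| + #|only_near r| = #|only_near q :|: only_near r|.
  by rewrite cardsU disjoint_setI0 // cards0 subn0.
pose phi x := odflt x [pick y in only_near p | joins p x y && (x != y)].
have src x : x \in only_near q :|: only_near r -> [/\ x \notin ends e,
    ~~ near p x & exists2 z, (z \in ends e) && (p != z) & near z x].
  rewrite inE => /orP[/(far _ _ qe)|/(far _ _ re)] [xe nx H]; split=> //.
  - exact: H.
  - by exists q; rewrite ?qe.
  - exact: H.
  - by exists r; rewrite ?re.
have phiP x : x \in only_near q :|: only_near r ->
    [/\ phi x \in only_near p, joins p x (phi x) & x != phi x].
  move=> /src[xe np _]; rewrite /phi; case: pickP => [y /and3P[]//|none].
  have [y [yp jy xy]] := not_near_joins pe xe np.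
  by have := none y; rewrite /= yp jy xy.
rewrite -(card_in_imset (f := phi)) => [|x x' xN x'N eqphi].
  by apply/subset_leq_card/subsetP => _ /imsetP[x /phiP[yp _ _] ->].
have [xe _ [z /andP[ze pz] nz]] := src x xN; have [x'e _ _] := src x' x'N.
have [/(far _ _ pe)[ye _ _] jx xy] := phiP x xN; have [_ jx' xy'] := phiP x' x'N.
rewrite -eqphi in jx' xy'.
exact: joins_inj pe ze pz xe x'e ye xy xy' nz jx jx'.
Qed.

(** By [card_only_near] all three sets are empty, so a vertex outside [e] is near [u], [v] and [w]
    through a single edge, which would have four vertices. *)
Lemma near_contradiction u v w : tr e u v w -> 3 < #|V| -> False.
Proof.
move=> t V4; have [ee uv uw vw _] := t.
have [ue ve we] : [/\ u \in ends e, v \in ends e & w \in ends e].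
  by rewrite ee !inE !eqxx !orbT.
have vu : v != u by rewrite eq_sym.
have wu : w != u by rewrite eq_sym.
have wv : w != v by rewrite eq_sym.
have add0 a b c : a + b <= c -> a + c <= b -> a = 0.
  move=> H1 H2; apply/eqP; rewrite -leqn0 -(leq_add2r b) add0n.
  by rewrite (leq_trans H1) // (leq_trans (leq_addl a c)).
have Nu : #|only_near u| = 0.
  apply: (add0 _ #|only_near v| #|only_near w|); first exact: card_only_near.
  exact: card_only_near.
have Nv : #|only_near v| = 0.
  apply: (add0 _ #|only_near u| #|only_near w|); first exact: card_only_near.
  exact: card_only_near.
have Nw : #|only_near w| = 0.
  apply: (add0 _ #|only_near u| #|only_near v|); first exact: card_only_near.
  exact: card_only_near.
have [x xe] : exists x, x \notin ends e.
  apply/existsP; apply: contraLR V4 => /existsPn H; rewrite -leqNgt -(card_ends e).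
  by apply/subset_leq_card/subsetP => x _; apply/negPn.
have nearx p : p \in ends e -> #|only_near p| = 0 -> near p x.
  move=> pe N0; apply: contraT => /(not_near_joins pe xe)[y [yN _ _]].
  by move/eqP: N0; rewrite cards_eq0 => /eqP N0; rewrite N0 inE in yN.
have /existsP[f tf] := nearx u ue Nu; have /existsP[g tg] := nearx v ve Nv.
have /existsP[h th] := nearx w we Nw.
have fg := near_unique ue ve uv xe tf tg; subst g.
have fh := near_unique ue we uw xe tf th; subst h.
have /and4P[_ uf xf _] := tf; have /and4P[_ vf _ _] := tg; have /and4P[_ wf _ _] := th.
have: #|x |: ends e| <= #|ends f|.
  apply/subset_leq_card/subsetP => z; rewrite ee !inE -!orbA.
  by move=> /or4P[]/eqP->.
by rewrite cardsU1 xe !card_ends.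
Qed.

End Repair.

(** If [e] keeps [u v], a chain avoiding [e] between any two of its vertices suffices: where needed,
    a step on [e] exchanges [w] for [u] or [v] as an end of the chain. *)
Lemma repair o u v : valid o -> u != v -> 3 < #|V| -> exists l, shift o l u v.
Proof.
move=> vo uv V4; have [e [w [t|t|t]]] := cover_triple vo uv; last 2 first.
- exists [:: (e, u, w, v)]; split=> // x.
  by rewrite /= addbF.
- exists [:: (e, v, w, u)]; split=> // x.
  by rewrite /= addbF addbC.
have [ee _ uw vw _] := t.
apply: NNPP => H; apply: (@near_contradiction o e vo _ u v w t V4) => p q pe qe pq.
case=> l [[st sh] el].
have st1 : steps o ((e, v, u, w) :: l) by split=> //; apply: tripleC.
have st2 : steps o ((e, u, v, w) :: l) by split.
move: pe qe pq; rewrite ee !inE -!orbA.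
move=> /or3P[]/eqP ep /or3P[]/eqP eq; subst p q; rewrite ?eqxx // => pq; apply: H.
- by exists l.
- exists ((e, v, u, w) :: l); split=> // x.
  by rewrite /= sh /st_from /st_to /=; case_eqs x.
- by exists l; split=> // x; rewrite sh addbC.
- exists ((e, u, v, w) :: l); split=> // x.
  by rewrite /= sh /st_from /st_to /=; case_eqs x.
- exists ((e, v, u, w) :: l); split=> // x.
  by rewrite /= sh /st_from /st_to /=; case_eqs x.
- exists ((e, u, v, w) :: l); split=> // x.
  by rewrite /= sh /st_from /st_to /=; case_eqs x.
Qed.

Lemma sum_parity o : valid o ->
  \big[addb/false]_x \big[addb/false]_e inc o e x = false.
Proof.
move=> vo; rewrite exchange_big /= big1 // => e _.
have [u [w t]] := triple_ex e vo; have [_ uw _ _ _] := t.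
apply: etrans (triple_crosses (fun=> true) t); rewrite /crosses [RHS]big_mkcond.
by apply: eq_bigr => x _; case: inc.
Qed.

Lemma exists_even_omission : 3 < #|V| -> exists o, valid o /\ even_omission o.
Proof.
move=> V4; have [o vo] : exists o : E -> V, valid o.
  apply: (@fin_all_exists _ (fun=> V) (fun e x => x \in ends e)) => e.
  by apply/set0Pn; rewrite -card_gt0 card_ends.
pose odds o := [set x | \big[addb/false]_e inc o e x].
have [n] := ubnP #|odds o|; elim: n o vo => // n IH o vo lt.
have [o0|] := eqVneq (odds o) set0.
  by exists o; split=> // x; have := in_set0 x; rewrite -o0 inE.
case/set0Pn=> u; rewrite inE => pu.
(* The number of odd vertices is even, so there is a second one. *)
have [v /andP[vu pv]] : exists v, (v != u) && \big[addb/false]_e inc o e v.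
  apply/existsP; apply: contraTT pu => /existsPn H.
  have := sum_parity vo; rewrite (bigD1 u) //= [X in _ (+) X]big1 ?addbF => [->//|v vu].
  by have := H v; rewrite vu => /negbTE.
have uv : u != v by rewrite eq_sym.
have [l [st sh]] := repair vo uv V4.
rewrite ltnS in lt; apply: (IH _ (apply_steps_valid vo st)); apply: leq_trans lt.
rewrite [X in _ < X](cardsD1 u) inE pu add1n ltnS.
apply/subset_leq_card/subsetP => x; rewrite !inE apply_steps_parity // sh.
have [<-|xu] := eqVneq u x; first by rewrite pu (eq_sym v) (negPf uv).
have [<-|xv] := eqVneq v x; first by rewrite pv.
by rewrite !addbF.
Qed.

End Omission.

(** * Hierholzer's construction on the multigraph of kept pairs *)

Section Tour.

Variables (H : hypergraph) (o : edge H -> vertex H) (B : {set vertex H}).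
Hypotheses (cardH : forall e : edge H, #|ends e| = 3) (vo : valid (@ends H) o).
Hypotheses (ev : even_omission (@ends H) o) (lkB : linked (@ends H) o B).
Hypothesis incB : forall e x, inc (@ends H) o e x -> x \in B.

Local Notation inc := (inc (@ends H) o).

Fixpoint pair_walk (v : vertex H) (w : seq (edge H * vertex H)) : bool :=
  if w is (e, v') :: w' then
    [&& inc e v, inc e v', v != v' & pair_walk v' w']
  else true.

Lemma pair_walk_is_walk v w : pair_walk v w -> is_walk v w.
Proof.
elim: w v => //= [[e v'] w IH] v /and4P[/andP[ve _] /andP[ve' _] vv /IH].
by rewrite ve ve' vv.
Qed.

Lemma pair_walk_cat v w1 w2 : pair_walk v (w1 ++ w2) =
  pair_walk v w1 && pair_walk (last v (unzip2 w1)) w2.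
Proof. by elim: w1 v => //= [[e v'] w IH] v /=; rewrite IH !andbA. Qed.

Lemma inc_pair e v v' x : inc e v -> inc e v' -> v != v' ->
  inc e x = (v == x) (+) (v' == x).
Proof.
have [a [b t]] := triple_ex cardH e vo; have [_ ab _ _ _] := t.
rewrite !(triple_inc _ t) !(eq_sym x).
have ba : b != a by rewrite eq_sym.
by move=> /orP[]/eqP-> /orP[]/eqP->; rewrite ?eqxx // => _;
  have [<-|_] := eqVneq a x; rewrite ?(negPf ab) ?(negPf ba) ?orbF //=; case: eqP.
Qed.

Lemma pair_walk_parity v w x : pair_walk v w ->
  \big[addb/false]_(e <- unzip1 w) inc e x = (v == x) (+) (last v (unzip2 w) == x).
Proof.
elim: w v => /= [v _|[e v'] w IH v /and4P[ve ve' vv /IH Ew]].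
  by rewrite big_nil addbb.
by rewrite big_cons /= Ew (inc_pair x ve ve' vv) addbA addbK.
Qed.

Lemma pair_walk_vertex v w x : pair_walk v w -> has (fun e => inc e x) (unzip1 w) ->
  x \in v :: unzip2 w.
Proof.
elim: w v => //= [[e v'] w IH] v /and4P[ve ve' vv /IH Ew] /orP[/=|/Ew].
  rewrite (inc_pair x ve ve' vv) !inE !(eq_sym x).
  by case: (v == x) => //= ->.
by rewrite !inE => ->; rewrite orbT.
Qed.

Lemma split_walk v w x : x \in v :: unzip2 w ->
  exists w1 w2 : seq (edge H * vertex H), w = w1 ++ w2 /\ last v (unzip2 w1) = x.
Proof.
elim: w v => /= [v|[e v'] w IH v].
  by rewrite inE => /eqP->; exists [::], [::].
rewrite inE => /orP[/eqP->|/IH[w1 [w2 [-> <-]]]]; first by exists [::], ((e, v') :: w).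
by exists ((e, v') :: w1), w2.
Qed.

Lemma rotate_walk v w x : pair_walk v w -> last v (unzip2 w) = v ->
  x \in v :: unzip2 w ->
  exists w', pair_walk x w' /\ perm_eq (unzip1 w') (unzip1 w).
Proof.
move=> pw cl /split_walk[w1 [w2 [ew ex]]]; subst w.
move: pw cl; rewrite pair_walk_cat ex => /andP[p1 p2].
rewrite /unzip2 map_cat last_cat -/(unzip2 w1) ex => cl.
exists (w2 ++ w1); rewrite pair_walk_cat p2 cl p1; split=> //.
by rewrite /unzip1 !map_cat perm_catC.
Qed.

Lemma prepend_edge v w g : pair_walk v w -> uniq (unzip1 w) ->
  g \notin unzip1 w -> inc g v -> exists v' w',
  [/\ pair_walk v' w', uniq (unzip1 w') & size w' = (size w).+1].
Proof.
move=> pw uw gw gv; have [a [b t]] := triple_ex cardH g vo; have [_ ab _ _ _] := t.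
have [u [gu uv]] : exists u, inc g u /\ u != v.
  move: gv; rewrite (triple_inc _ t) => /orP[]/eqP->; [exists b|exists a];
  by rewrite (triple_inc _ t) eqxx ?orbT; split=> //; rewrite eq_sym.
exists u, ((g, v) :: w); rewrite /= gu gv uv pw gw uw; split=> //.
Qed.

Lemma extend_trail v w f : pair_walk v w -> uniq (unzip1 w) ->
  f \notin unzip1 w -> exists v' w',
  [/\ pair_walk v' w', uniq (unzip1 w') & size w' = (size w).+1].
Proof.
move=> pw uw fw.
case: (classic (exists x g, [/\ g \notin unzip1 w, inc g x & x \in v :: unzip2 w
    /\ last v (unzip2 w) = v])) => [[x [g [gw gx [xw cl]]]]|noex].
  have [w' [pw' pe]] := rotate_walk pw cl xw.
  have sz : size w' = size w by rewrite -(size_map fst w') (perm_size pe) size_map.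
  rewrite -sz; apply: (prepend_edge pw' _ _ gx);
  by rewrite ?(perm_uniq pe) ?(perm_mem pe).
have [cl|ncl] := eqVneq (last v (unzip2 w)) v; last first.
  have [g gw gv] : exists2 g, g \notin unzip1 w & inc g v.
    apply: NNPP => no; have := pair_walk_parity v pw.
    rewrite eqxx (negPf ncl) big_uniq //= => par.
    have := ev v; rewrite (bigID [in unzip1 w]) /= par big1 // => g gw.
    by apply/negP => gv; apply: no; exists g.
  exact: prepend_edge gw gv.
have fresh g x : g \notin unzip1 w -> inc g x -> x \notin v :: unzip2 w.
  by move=> gw gx; apply/negP => xw; apply: noex; exists x, g.
case: w pw uw fw noex cl fresh => [|[e v'] w] pw uw fw noex cl fresh.
  have [a [b t]] := triple_ex cardH f vo; apply: (prepend_edge (v := a) _ _ fw) => //.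
  by rewrite (triple_inc _ t) eqxx.
set w1 := (e, v') :: w in pw uw fw noex cl fresh *.
pose Q x := has (fun e => inc e x) (unzip1 w1).
have Q0 g : crosses (@ends H) o Q g = false.
  have [a [b t]] := triple_ex cardH g vo; rewrite (triple_crosses _ t).
  have ga : inc g a by rewrite (triple_inc _ t) eqxx.
  have gb : inc g b by rewrite (triple_inc _ t) eqxx orbT.
  have [gw|gw] := boolP (g \in unzip1 w1).
    have -> : Q a by apply/hasP; exists g.
    by have -> : Q b by apply/hasP; exists g.
  have nQ x : inc g x -> Q x = false.
    by move=> gx; apply: contraNF (fresh g x gw gx); apply: pair_walk_vertex.
  by rewrite !nQ.
have [a [b t]] := triple_ex cardH f vo.
have fa : inc f a by rewrite (triple_inc _ t) eqxx.
have ve : inc e v by case/and4P: pw.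
have := lkB Q0 (incB fa) (incB ve).
have -> : Q v by rewrite /Q /= ve.
by move/(pair_walk_vertex pw); rewrite (negPf (fresh f a fw fa)).
Qed.

Lemma spanning_trail : exists v w,
  [/\ pair_walk v w, uniq (unzip1 w) & forall e, e \in unzip1 w].
Proof.
suff ext v w : pair_walk v w -> uniq (unzip1 w) -> exists v' w',
    [/\ pair_walk v' w', uniq (unzip1 w') & forall e, e \in unzip1 w'].
  by have /card_gt0P[v _] := vertex_nonempty H; apply: (ext v [::]).
have [n] := ubnP (#|edge H| - size w); elim: n v w => // n IH v w lt pw uw.
have [/forallP all|/forallPn[f fw]] := boolP [forall e, e \in unzip1 w].
  by exists v, w.
have [v' [w' [pw' uw' sz]]] := extend_trail pw uw fw.
apply: (IH v' w') => //; rewrite ltnS in lt; apply: leq_trans lt; rewrite sz.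
have szw : size w < #|edge H|.
  rewrite -(size_map fst) -(card_uniqP uw) [X in _ < X](cardD1 f) add1n ltnS.
  apply/subset_leq_card/subsetP => e ew.
  by rewrite !inE andbT; apply: contraNneq fw => <-.
by rewrite ltn_sub2l.
Qed.

Lemma euler_tour_of_omission : 0 < #|edge H| -> exists v w, euler_tour (H := H) v w.
Proof.
move=> E0; have [v [w [pw uw all]]] := spanning_trail.
exists v, w; split.
- by rewrite /is_trail pair_walk_is_walk.
- have cl : v = last v (unzip2 w).
    apply/eqP; have := pair_walk_parity v pw; rewrite eqxx big_uniq //=.
    have -> : \big[addb/false]_(e | e \in unzip1 w) inc e v = false.
      by rewrite -[RHS](ev v); apply: eq_bigl => e; rewrite all.
    by rewrite eq_sym; case: eqP.
  rewrite /is_closed {1}cl eqxx; have /card_gt0P[e _] := E0.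
  (* A closed walk of length one is impossible, since consecutive vertices differ. *)
  case: w pw uw all cl => [|[f u] [|//]] pw _ all cl; first by have := all e.
  by case/and4P: pw => _ _; rewrite {1}cl eqxx.
by move=> e; rewrite count_uniq_mem // all.
Qed.

End Tour.

Theorem theorem4p13 (H : hypergraph) :
  covering_3hypergraph H -> 7 <= horder H -> eulerian H.
Proof.
case=> E0 cardH cov V7; right.
have V5 : 4 < #|vertex H| by apply: leq_trans V7.
have /card_gt0P[e _] := E0.
have [||o [B [vo ev lkB incB]]] := exists_maximal_linked cardH cov V5.
- by apply: exists_even_omission => //; apply: ltnW.
- by exists e.
exact: euler_tour_of_omission cardH vo ev lkB incB E0.
Qed.
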